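(* Let $H\in\mathbb{R}^{N\times M}$ have positive entries, let $y\in\mathbb{R}^N$, $y\neq0$, be data with nonnegative components, and fix $\tau>0$ and an initialization $x^{(0)}$ with positive components. Consider the constrained backprojected residual (CBR) criterion: stop EM at the first iteration $k$ such that $$\left\| x^{(k)}\, H^T \Big( 1-\frac{y}{Hx^{(k)}} \Big) \right\|^2 \;\le\; \tau\sum_{j=1}^M (x_j^{(k)})^2 \sum_{i=1}^N \frac{H_{ij}^2}{(Hx^{(k)})_i},$$ where $x^{(k)}$ is the EM iteration for the data $y$. Then EM supplied with the CBR criterion is a well-defined regularization method for the constrained maximum likelihood problem with Poisson noise (with no requirement that $y\in H(\mathcal{C})$).
   Context: Products and quotients of vectors are taken componentwise; $1$ is the vector of ones; $\|\cdot\|$ is the Euclidean norm; $\mathcal{C}=\{x\in\mathbb{R}^M : x_j\ge 0\ \forall j\}$ and $H(\mathcal{C})=\{Hx : x\in\mathcal{C}\}$. In the Poisson model the data are independent Poisson variables with means $(Hx)_i$, and the constrained maximum likelihood problem is to minimize over $x\in\mathcal{C}$ the Kullback–Leibler divergence $D_{KL}(y,x)=\sum_{i=1}^N \big( y_i\log\frac{y_i}{(Hx)_i}+(Hx)_i-y_i\big)$, with the conventions $0\log(0/t)=0$ for $t\ge0$ and $s\log(s/0)=+\infty$ for $s>0$. EM is the iteration $x^{(k+1)}=\dfrac{x^{(k)}}{H^T1}\,H^T\dfrac{y}{Hx^{(k)}}$. It is a known fact, taken for granted, that EM converges to a minimizer of $D_{KL}(y,\cdot)$ over $\mathcal{C}$.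 Definition (regularization method). An iterative method with a stopping rule is a regularization method if (1) the iterates $y\mapsto x^{(k)}$ are defined for all data $y$ of the form $Hx$, $x\in\mathcal{C}\setminus\{0\}$; and (2) the stopping rule selects an iteration index such that the stopped iterate tends (asymptotically) to a solution $\hat x$ of the constrained maximum likelihood problem as the coefficient of variation $\delta$ (standard deviation divided by mean) tends to zero. In the Poisson case $\delta\to0$ means that the data tend to infinity, i.e. $y$ is replaced by $y_L=Ly$ with $L\to\infty$. Denote by $x_L^{(k)}$ the EM iterates for the data $y_L$ with the same initialization $x^{(0)}$. Then (2) reads: for every $L>0$ some iteration satisfies the stopping inequality written with $y_L$ and $x_L^{(k)}$ in place of $y$ and $x^{(k)}$, and, writing $k(L)$ for the first such iteration, $\lim_{L\to\infty}\frac1L x_L^{(k(L))}=\hat x$ for some minimizer $\hat x$ of $D_{KL}(y,\cdot)$ over $\mathcal{C}$. *)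

(* Defs.v *)
From HB Require Import structures.
From mathcomp Require Import all_boot all_order all_algebra.
From mathcomp Require Import all_classical all_reals all_analysis.
Import Order.TTheory GRing.Theory Num.Theory.
Import numFieldNormedType.Exports.

Set Implicit Arguments.
Unset Strict Implicit.
Unset Printing Implicit Defensive.

Local Open Scope classical_set_scope.
Local Open Scope ring_scope.

Section Vectors.
Context {R : realType} {n : nat}.
Implicit Types u v : 'cV[R]_n.

Definition ones : 'cV[R]_n := const_mx 1.

Definition vmul u v : 'cV[R]_n := map2_mx *%R u v.

(* Componentwise quotient, undefined as soon as one denominator vanishes. *)
Definition vdiv u v : option 'cV[R]_n :=
  if [forall i, v i 0 != 0] then Some (\col_i (u i 0 / v i 0)) else None.

(* The library norm on matrices is the maximum norm, hence this definition. *)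
Definition enorm v : R := Num.sqrt (\sum_i v i 0 ^+ 2).

Definition orthant : set 'cV[R]_n := [set x | forall j, 0 <= x j 0].

End Vectors.

Section MaximumLikelihood.
Context {R : realType} {N M : nat}.
Variable H : 'M[R]_(N, M).

(* s log (s / t), with 0 log (0 / t) = 0 and s log (s / 0) = +oo for s > 0;
   it is only meant for s, t >= 0. *)
Definition slog (s t : R) : \bar R :=
  if s == 0 then 0%E else if t == 0 then +oo%E else (s * ln (s / t))%:E.

Definition KL (y : 'cV[R]_N) (x : 'cV[R]_M) : \bar R :=
  (\sum_(i < N) (slog (y i 0%R) ((H *m x) i 0%R)
                 + ((H *m x) i 0 - y i 0)%:E))%E.

Definition ML_solution (y : 'cV[R]_N) (x : 'cV[R]_M) : Prop :=
  orthant x /\ forall z, orthant z -> (KL y x <= KL y z)%E.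

End MaximumLikelihood.

Section RegularizationMethod.
Context {R : realType} {N M : nat}.

(* [X y k] is the k-th iterate for the data y, [None] when it is undefined. *)
Definition iterative_method := 'cV[R]_N -> nat -> option 'cV[R]_M.

(* [S y x] says that the stopping inequality for the data y holds at x. *)
Definition stopping_rule := 'cV[R]_N -> 'cV[R]_M -> bool.

Implicit Types (X : iterative_method) (S : stopping_rule).

(* k is the first iteration that meets the rule, and x is the k-th iterate. *)
Definition first_stop X S (y : 'cV[R]_N) (k : nat) (x : 'cV[R]_M) : Prop :=
  [/\ X y k = Some x, S y x &
      forall l z, (l < k)%N -> X y l = Some z -> ~~ S y z].

(* Vanishing coefficient of variation for Poisson data means that y is
   replaced by L y with L -> +oo. The functions k and xs below are determined
   by [first_stop] at every L > 0. *)
Definition regularization_method (H : 'M[R]_(N, M)) (y : 'cV[R]_N) X S : Prop :=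
  (forall x, orthant x -> x != 0 -> forall k, isSome (X (H *m x) k)) /\
  exists (k : R -> nat) (xs : R -> 'cV[R]_M),
    (forall L, 0 < L -> first_stop X S (L *: y) (k L) (xs L)) /\
    exists2 xhat, ML_solution H y xhat &
      (L^-1 *: xs L) @[L --> +oo%R] --> xhat.

End RegularizationMethod.

Section EM.
Context {R : realType} {N M : nat}.
Variable H : 'M[R]_(N, M).

Definition EM_step (y : 'cV[R]_N) (x : 'cV[R]_M) : option 'cV[R]_M :=
  if vdiv x (H^T *m ones) is Some w then
    if vdiv y (H *m x) is Some r then Some (vmul w (H^T *m r)) else None
  else None.

Definition EM_method (x0 : 'cV[R]_M) : iterative_method :=
  fun y k => iter k (obind (EM_step y)) (Some x0).

Definition CBR (tau : R) : stopping_rule := fun y x =>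
  if vdiv y (H *m x) is Some r then
    enorm (vmul x (H^T *m (ones - r))) ^+ 2 <=
      tau * \sum_(j < M) x j 0 ^+ 2 *
                         \sum_(i < N) H i j ^+ 2 / (H *m x) i 0
  else false.

End EM.

(* Main.v *)
(* EM alternates between the matrix P_ij(x) = H_ij x_j y_i / (Hx)_i (post), whose
   rows sum to y, and the vector em x, which is its vector of column sums divided
   by H^T 1.  Let c(z, x) = sum_ij P_ij(z) ln (x_j / (Hx)_i) (crossent).  Two
   convexity inequalities, for all z >= 0 with Hz > 0, do the work:
     c(z, em x) - c(z, x) >= loglik z - loglik (em x),
     c(z, z) - c(z, x) >= sum_ij (sqrt P_ij(z) - sqrt P_ij(x))^2.
   So loglik increases along EM, and no z beats a cluster point p of the iterates
   (else c(z, .) would grow linearly, against the second inequality).  Hence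
   c(p, .) increases along EM, up to c(p, p) by continuity along a subfamily;
   thus P(x_k) -> P(p) and x_(k+1) -> em p, a maximizer of loglik.

   From its first iteration on, EM for the data L y is L times EM for y, and CBR
   at L x_k reads L a_k <= tau b_k, where a_k = |(H^T 1) (x_k - x_(k+1))|^2 -> 0
   and b_k has a positive limit, so EM always stops.  As L -> +oo the index 0 is
   excluded, and so is every k below a given bound unless a_k = 0; but then x_k
   is a fixed point of EM and already equals the limit. *)
Require Import Defs.
From HB Require Import structures.
From mathcomp Require Import all_boot all_order all_algebra.
From mathcomp Require Import all_classical all_reals all_analysis.
From mathcomp Require Import ring lra.
Import Order.TTheory GRing.Theory Num.Theory.
Import numFieldNormedType.Exports.
Local Open Scope classical_set_scope.
Local Open Scope ring_scope.

(** * Tangent bounds for the logarithm *)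

Lemma ler_ln_subr1 {R : realType} (u : R) : 0 < u -> ln u <= u - 1.
Proof.
move=> u0; have -> : ln u = ln (1 + (u - 1)) by congr ln; ring.
by apply: le_ln1Dx; lra.
Qed.

(** The tangent bound is taken at [sqrt u], which is what makes squared differences of square roots
    appear in [crossent_gap]. *)
Lemma ler_ln_sqrt {R : realType} (u : R) : 0 < u -> ln u <= 2 * (Num.sqrt u - 1).
Proof.
move=> u0; have su : 0 < Num.sqrt u by rewrite sqrtr_gt0.
have -> : ln u = 2 * ln (Num.sqrt u).
  rewrite -[in LHS](sqr_sqrtr (ltW u0)) expr2 lnM ?posrE //; ring.
by rewrite ler_pM2l //; exact: ler_ln_subr1.
Qed.

(** * Convexity inequalities for EM *)

Section Posterior.
Context {R : realType} {N M : nat}.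
Implicit Types (H : 'M[R]_(N, M)) (y : 'cV[R]_N) (x z : 'cV[R]_M).

Definition post H y x i j : R := H i j * x j 0 * (y i 0 / (H *m x) i 0).

Definition em H y x : 'cV[R]_M :=
  \col_j ((\sum_i post H y x i j) / (\sum_i H i j)).

(** The Poisson log-likelihood, up to terms in [y] alone. *)
Definition loglik H y x : R :=
  \sum_i (y i 0 * ln ((H *m x) i 0) - (H *m x) i 0).

(** The factors [H i j] and [y i 0] of [post H y x i j] are left out of the logarithm because they
    cancel in differences. *)
Definition crossent H y z x : R :=
  \sum_i \sum_j post H y z i j * ln (x j 0 / (H *m x) i 0).

Lemma mulmx_col_gt0 H x : (forall i j, 0 < H i j) -> orthant x -> x != 0 ->
  forall i, 0 < (H *m x) i 0.
Proof.
move=> hH hx x0 i; have [j hj] : exists j, x j 0 != 0.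
  by have /matrix0Pn[j [k]] := x0; rewrite (ord1 k); exists j.
rewrite mxE (bigD1 j) //= ltr_wpDr //.
  by apply: sumr_ge0 => l _; rewrite mulr_ge0 // ?ltW //; exact: hx.
by rewrite mulr_gt0 // lt_def hj; exact: hx.
Qed.

Lemma sum_mulmx_col H x :
  \sum_i (H *m x) i 0 = \sum_j (\sum_i H i j) * x j 0.
Proof.
under eq_bigr do rewrite mxE.
by rewrite exchange_big /=; apply: eq_bigr => j _; rewrite big_distrl.
Qed.

Lemma post_ge0 H y x i j : (forall i j, 0 < H i j) -> (forall i, 0 <= y i 0) ->
  orthant x -> 0 < (H *m x) i 0 -> 0 <= post H y x i j.
Proof.
move=> hH hy hx hp; rewrite mulr_ge0 ?divr_ge0 ?(ltW hp) //.
by rewrite mulr_ge0 // ?ltW //; exact: hx.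
Qed.

Lemma sum_post H y x i : 0 < (H *m x) i 0 -> \sum_j post H y x i j = y i 0.
Proof.
move=> hp; rewrite -big_distrl /=.
have -> : \sum_j H i j * x j 0 = (H *m x) i 0 by rewrite mxE.
by rewrite mulrC divfK // gt_eqF.
Qed.

Section Fixed.
Variables (H : 'M[R]_(N, M)) (y : 'cV[R]_N).
Hypotheses (hH : forall i j, 0 < H i j) (hy : forall i, 0 <= y i 0).
Hypothesis (hy0 : y != 0).

Lemma data_pos : exists i, 0 < y i 0.
Proof.
have /matrix0Pn[i [k]] := hy0; rewrite (ord1 k) => h; exists i.
by rewrite lt_def h hy.
Qed.

Lemma sum_data_gt0 : 0 < \sum_i y i 0.
Proof.
have [i hi] := data_pos; rewrite (bigD1 i) //= ltr_wpDr //.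
by apply: sumr_ge0 => l _.
Qed.

(** A zero [x] would give [H x] mass 0, against the positive mass of [y]. *)
Lemma mulmx_gt0_of_mass (x : 'cV[R]_M) : orthant x ->
  \sum_i (H *m x) i 0 = \sum_i y i 0 -> forall i, 0 < (H *m x) i 0.
Proof.
move=> hx hs; apply: mulmx_col_gt0 => //; apply: contraTneq sum_data_gt0 => x0.
by rewrite -hs x0 mulmx0 big1 ?ltxx // => i _; rewrite mxE.
Qed.

Lemma colsum_gt0 j : 0 < \sum_i H i j.
Proof.
(* Since [y != 0], there is a row and the sum is not empty. *)
have [i _] := data_pos; rewrite (bigD1 i) //= ltr_wpDr //.
by apply: sumr_ge0 => l _; exact: ltW.
Qed.

Lemma colsum_em x j : (\sum_i H i j) * em H y x j 0 = \sum_i post H y x i j.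
Proof. by rewrite mxE mulrC divfK // gt_eqF // colsum_gt0. Qed.

Lemma em_mass x : (forall i, 0 < (H *m x) i 0) ->
  \sum_i (H *m em H y x) i 0 = \sum_i y i 0.
Proof.
move=> hx; rewrite sum_mulmx_col; under eq_bigr do rewrite colsum_em.
by rewrite exchange_big /=; apply: eq_bigr => i _; exact: sum_post.
Qed.

Lemma em_ge0 x : (forall i, 0 < (H *m x) i 0) -> orthant x -> orthant (em H y x).
Proof.
move=> hp hx j; rewrite mxE divr_ge0 ?(ltW (colsum_gt0 _)) //.
by apply: sumr_ge0 => i _; exact: post_ge0.
Qed.

Lemma em_gt0 x : (forall i, 0 < (H *m x) i 0) ->
  (forall j, 0 < x j 0) -> forall j, 0 < em H y x j 0.
Proof.
move=> hp hx j; rewrite mxE divr_gt0 ?colsum_gt0 //.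
have [i hi] := data_pos; rewrite (bigD1 i) //= ltr_wpDr //.
  by apply: sumr_ge0 => l _; apply: post_ge0 => // k; exact: ltW.
by rewrite /post !mulr_gt0 ?invr_gt0.
Qed.

(** This is [ln u <= u - 1] at [u = (Hz)_i x_j / (x'_j (Hx)_i)], summed with the weights
    [post H y z]. The logarithms give the cross-entropies and the logarithmic part of [loglik]; the
    linear terms give the masses in [loglik]. *)
Lemma crossent_em x z : (forall j, 0 < x j 0) -> (forall i, 0 < (H *m x) i 0) ->
  orthant z -> (forall i, 0 < (H *m z) i 0) ->
  loglik H y z - loglik H y (em H y x) <=
  crossent H y z (em H y x) - crossent H y z x.
Proof.
move=> x0 hx z0 hz; set x' := em H y x.
have x'0 : forall j, 0 < x' j 0 by exact: em_gt0.
have hx' : forall i, 0 < (H *m x') i 0.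
  apply: mulmx_gt0_of_mass; last exact: em_mass.
  by move=> j; exact: ltW.
pose t i j := post H y z i j * (1 - (H *m z) i 0 * x j 0 / (x' j 0 * (H *m x) i 0)).
have st : \sum_i \sum_j t i j = \sum_i (H *m x') i 0 - \sum_i (H *m z) i 0.
  (* The factor [u] turns [post H y z i j] into [z_j / x'_j] times [post H y x i j], whose column
     sums contain [x'_j]. *)
  have -> : \sum_i \sum_j t i j = \sum_i \sum_j post H y z i j -
      \sum_j z j 0 / x' j 0 * \sum_i post H y x i j.
    under [in X in _ - X]eq_bigr do rewrite big_distrr /=.
    rewrite [in X in _ - X]exchange_big -sumrB; apply: eq_bigr => i _ /=.
    rewrite -sumrB; apply: eq_bigr => j _; rewrite /t /post.
    have := hz i; have := hx i; have := x'0 j => *; field.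
    by rewrite !gt_eqF.
  rewrite em_mass //; congr (_ - _).
    by apply: eq_bigr => i _; exact: sum_post.
  rewrite sum_mulmx_col; apply: eq_bigr => j _.
  rewrite -colsum_em -/x'; have := x'0 j => h; field.
  by rewrite gt_eqF.
have tle i : \sum_j t i j <=
    \sum_j post H y z i j * ln (x' j 0 / (H *m x') i 0) -
    \sum_j post H y z i j * ln (x j 0 / (H *m x) i 0) -
    y i 0 * (ln ((H *m z) i 0) - ln ((H *m x') i 0)).
  rewrite -(sum_post H y z i (hz i)) big_distrl -!sumrB /=.
  apply: ler_sum => j _; rewrite /t -!mulrBr.
  rewrite ler_wpM2l ?post_ge0 //.
  have u0 : 0 < (H *m z) i 0 * x j 0 / (x' j 0 * (H *m x) i 0).
    by rewrite divr_gt0 ?mulr_gt0.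
  by have := ler_ln_subr1 _ u0; rewrite !ln_div ?lnM ?posrE ?mulr_gt0 //; lra.
have {tle} : \sum_i \sum_j t i j <= _ := ler_sum _ (fun i _ => tle i).
rewrite st !sumrB /loglik !sumrB -/(crossent H y z x) -/(crossent H y z x').
have -> : \sum_i y i 0 * (ln ((H *m z) i 0) - ln ((H *m x') i 0)) =
    \sum_i y i 0 * ln ((H *m z) i 0) - \sum_i y i 0 * ln ((H *m x') i 0).
  by rewrite -sumrB; apply: eq_bigr => i _; rewrite mulrBr.
by lra.
Qed.

(** The right side is the relative entropy between two arrays with the same row sums; [ler_ln_sqrt]
    bounds it below by a squared Hellinger distance. *)
Lemma crossent_gap x z : (forall j, 0 < x j 0) -> (forall i, 0 < (H *m x) i 0) ->
  orthant z -> (forall i, 0 < (H *m z) i 0) ->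
  \sum_i \sum_j (Num.sqrt (post H y z i j) - Num.sqrt (post H y x i j)) ^+ 2 <=
  crossent H y z z - crossent H y z x.
Proof.
move=> x0 hx z0 hz.
have px i j : 0 <= post H y x i j by apply: post_ge0 => // k; exact: ltW.
have pz i j : 0 <= post H y z i j by exact: post_ge0.
(* The expanded square with [post H y x] replaced by [post H y z]; both rows sum to [y i 0], so this
   is exact only after summing over [j]. *)
pose t i j := 2 * post H y z i j
  - 2 * (Num.sqrt (post H y z i j) * Num.sqrt (post H y x i j)).
have -> : \sum_i \sum_j (Num.sqrt (post H y z i j) - Num.sqrt (post H y x i j)) ^+ 2
    = \sum_i \sum_j t i j.
  apply: eq_bigr => i _.
  under eq_bigr do rewrite sqrrB !sqr_sqrtr //.
  rewrite big_split sumrB /= [X in _ + X](_ : _ = \sum_j post H y z i j).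
    rewrite -sumrB -big_split /=; apply: eq_bigr => j _; rewrite /t; ring.
  by rewrite !sum_post.
rewrite /crossent -sumrB; apply: ler_sum => i _.
rewrite -sumrB; apply: ler_sum => j _; rewrite /t.
(* Terms of zero weight vanish; a positive weight forces [z j 0] and [y i 0] to be positive, so the
   logarithms split. *)
have := pz i j; rewrite le_eqVlt => /orP[/eqP <-|pz0].
  by rewrite sqrtr0 !(mulr0, mul0r, subrr).
have zj : 0 < z j 0.
  have := z0 j; rewrite le_eqVlt => /orP[/eqP zj|//].
  by move: pz0; rewrite /post -zj !(mulr0, mul0r) ltxx.
have yi : 0 < y i 0.
  have := hy i; rewrite le_eqVlt => /orP[/eqP yj|//].
  by move: pz0; rewrite /post -yj !(mulr0, mul0r) ltxx.
have px0 : 0 < post H y x i j by rewrite /post !mulr_gt0 ?invr_gt0.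
have := ler_ln_sqrt (post H y x i j / post H y z i j) (divr_gt0 px0 pz0).
rewrite ln_div ?posrE // sqrtrM // sqrtrV //.
have -> : ln (post H y x i j) - ln (post H y z i j)
    = ln (x j 0 / (H *m x) i 0) - ln (z j 0 / (H *m z) i 0).
  rewrite /post.
  by rewrite !(lnM, ln_div) ?posrE ?(mulr_gt0, divr_gt0, invr_gt0) //; ring.
move=> /(ler_wpM2l (ltW pz0)).
have spz : 0 < Num.sqrt (post H y z i j) by rewrite sqrtr_gt0.
have -> : post H y z i j *
     (2 * (Num.sqrt (post H y x i j) / Num.sqrt (post H y z i j) - 1))
   = 2 * (Num.sqrt (post H y z i j) * Num.sqrt (post H y x i j)) - 2 * post H y z i j.
  rewrite -{1 4}(sqr_sqrtr (pz i j)); field.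
  by rewrite gt_eqF.
lra.
Qed.

(** Both inequalities at [z = x] bound the decrease of [loglik] by [c(x, em x) - c(x, x) <= 0]. *)
Lemma loglik_em x : (forall j, 0 < x j 0) -> (forall i, 0 < (H *m x) i 0) ->
  loglik H y x <= loglik H y (em H y x).
Proof.
move=> x0 hx; have hxo : orthant x by move=> j; exact: ltW.
have hx' : forall i, 0 < (H *m em H y x) i 0.
  by apply: mulmx_gt0_of_mass; [exact: em_ge0 | exact: em_mass].
have := crossent_em x x x0 hx hxo hx.
have := crossent_gap (em H y x) x (em_gt0 x hx x0) hx' hxo hx.
rewrite -(subr_ge0 (loglik _ _ _)) => h1 h2.
suff : 0 <= \sum_i \sum_j (Num.sqrt (post H y x i j) -
    Num.sqrt (post H y (em H y x) i j)) ^+ 2 by lra.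
by apply: sumr_ge0 => i _; apply: sumr_ge0 => j _; exact: sqr_ge0.
Qed.

End Fixed.
End Posterior.

(** * Convergence of EM *)

Lemma ultra_map {T U : Type} (f : T -> U) (F : set_system T) :
  UltraFilter F -> UltraFilter (f @ F).
Proof.
move=> FU; have FF := @ultra_proper _ _ FU; split; first exact: fmap_proper_filter.
move=> G GF FG; apply/seteqP; split => // A GA.
have [//|nA] := in_ultra_setVsetC (f @^-1` A) FU.
have : G (A `&` ~` A) by apply: filterI => //; exact: FG.
by rewrite setICr => /filter_not_empty.
Qed.

(** Compactness in ultrafilter form. One ultrafilter serves all coordinates at once, in place of
    successive subsequences. *)
Lemma ultra_segment_cvg {R : realType} {T : Type} (F : set_system T) (f : T -> R)
    (a b : R) : UltraFilter F -> (forall t, a <= f t <= b) ->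
  exists p : R, f t @[t --> F] --> p.
Proof.
move=> FU hf; have FF := @ultra_proper _ _ FU.
have := @segment_compact R a b; rewrite compact_ultra => /(_ (f @ F)).
case; first exact: ultra_map.
  by apply: (@filterE _ F) => t /=; rewrite in_itv; exact: hf.
by move=> p [_ hp]; exists p.
Qed.

(** * Continuity of the functionals along a filter *)

Section Continuity.
Context {R : realType} {N M : nat}.
Variables (H : 'M[R]_(N, M)) (y : 'cV[R]_N).
Context {T : Type} {F : set_system T} {FF : Filter F}.
Variables (X : T -> 'cV[R]_M) (p : 'cV[R]_M).
Hypothesis hX : forall j, X t j 0 @[t --> F] --> p j 0.

Lemma cvg_rsum (n : nat) (f : 'I_n -> T -> R) (l : 'I_n -> R) :
  (forall i, f i t @[t --> F] --> l i) ->
  \sum_i f i t @[t --> F] --> \sum_i l i.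
Proof. by move=> h; apply: cvg_big => //; exact: add_continuous. Qed.

Lemma cvg_mulmx_col i : (H *m X t) i 0 @[t --> F] --> (H *m p) i 0.
Proof.
rewrite mxE; under eq_fun do rewrite mxE.
by apply: cvg_rsum => j; apply: cvgM => //; exact: cvg_cst.
Qed.

Lemma cvg_ln (f : T -> R) (l : R) : 0 < l ->
  f t @[t --> F] --> l -> ln (f t) @[t --> F] --> ln l.
Proof. by move=> l0 fl; apply: continuous_cvg fl; exact: continuous_ln. Qed.

Lemma cvg_loglik : (forall i, 0 < (H *m p) i 0) ->
  loglik H y (X t) @[t --> F] --> loglik H y p.
Proof.
move=> h; apply: cvg_rsum => i; apply: cvgB; last exact: cvg_mulmx_col.
by apply: cvgM; [exact: cvg_cst | apply: cvg_ln => //; exact: cvg_mulmx_col].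
Qed.

Lemma cvg_crossent : orthant p -> (forall i, 0 < (H *m p) i 0) ->
  crossent H y p (X t) @[t --> F] --> crossent H y p p.
Proof.
move=> p0 h; apply: cvg_rsum => i; apply: cvg_rsum => j.
(* Where [p j 0 = 0] the logarithm may diverge, but its weight is 0. *)
have := p0 j; rewrite le_eqVlt => /orP[/eqP pj|pj].
  rewrite /post -pj !(mulr0, mul0r).
  by under eq_fun do rewrite mul0r; exact: cvg_cst.
apply: cvgM; first exact: cvg_cst.
apply: cvg_ln; first by rewrite divr_gt0.
by apply: cvgM => //; apply: cvgV; [rewrite gt_eqF | exact: cvg_mulmx_col].
Qed.

End Continuity.

Lemma cvg_of_sqr {R : realType} {T : Type} {F : set_system T} {FF : Filter F}
  (f : T -> R) (l : R) (g : T -> R) : (forall t, (l - f t) ^+ 2 <= g t) ->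
  g t @[t --> F] --> 0 -> f t @[t --> F] --> l.
Proof.
move=> fg g0; apply/cvgrPdist_lt => e e0.
have e2 : 0 < e ^+ 2 by rewrite exprn_gt0.
move/cvgrPdist_lt: g0 => /(_ _ e2); apply: filterS => t.
rewrite sub0r normrN => /(le_lt_trans (ler_norm _)) /(le_lt_trans (fg t)).
by rewrite -[X in X < _]real_normK ?num_real // ltr_pXn2r // ?nnegrE ?ltW.
Qed.

Section Convergence.
Context {R : realType} {N M : nat}.
Variables (H : 'M[R]_(N, M)) (y : 'cV[R]_N).
Hypotheses (hH : forall i j, 0 < H i j) (hy : forall i, 0 <= y i 0).
Hypothesis (hy0 : y != 0).

Lemma em_iter_gt0 (x : 'cV[R]_M) n : (forall j, 0 < x j 0) ->
  (forall i, 0 < (H *m x) i 0) ->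
  (forall j, 0 < iter n (em H y) x j 0) /\
  (forall i, 0 < (H *m iter n (em H y) x) i 0).
Proof.
move=> x0 hx; elim: n => [//|n [IH1 IH2]] /=.
have e0 : orthant (em H y (iter n (em H y) x)).
  by apply: em_ge0 => // j; exact: ltW.
split; first exact: em_gt0.
by apply: (mulmx_gt0_of_mass H y) => //; exact: em_mass.
Qed.

(** The mass condition holds from the first EM iterate on and keeps the whole sequence in a compact
    box. *)
Lemma em_cvg_max (x0 : 'cV[R]_M) : (forall j, 0 < x0 j 0) ->
  (forall i, 0 < (H *m x0) i 0) ->
  \sum_i (H *m x0) i 0 = \sum_i y i 0 ->
  exists w : 'cV[R]_M, [/\ orthant w, forall i, 0 < (H *m w) i 0,
    forall j, iter n (em H y) x0 j 0 @[n --> \oo] --> w j 0 &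
    forall z, orthant z -> (forall i, 0 < (H *m z) i 0) ->
      loglik H y z <= loglik H y w].
Proof.
move=> hx0 hHx0 hs0; pose x n := iter n (em H y) x0.
have xp n : forall j, 0 < x n j 0 by have [] := em_iter_gt0 x0 n hx0 hHx0.
have hp n : forall i, 0 < (H *m x n) i 0 by have [] := em_iter_gt0 x0 n hx0 hHx0.
have xo n : orthant (x n) by move=> j; exact: ltW.
have xmass n : \sum_i (H *m x n) i 0 = \sum_i y i 0.
  by case: n => [//|n]; exact: em_mass.
have xbd n j : 0 <= x n j 0 <= (\sum_i y i 0) / \sum_i H i j.
  rewrite (xo n j) /= ler_pdivlMr ?(colsum_gt0 H y) // -(xmass n) sum_mulmx_col.
  rewrite (bigD1 j) //= mulrC lerDl; apply: sumr_ge0 => k _.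
  by rewrite mulr_ge0 ?xo // ltW // (colsum_gt0 H y).
(* The limit [p] along an ultrafilter finer than [\oo] plays the role of a cluster point. *)
have [U [UU oU]] := @ultraFilterLemma nat \oo _.
have UF := @ultra_proper _ _ UU.
have [p hpU] : exists p : 'cV[R]_M, forall j, x n j 0 @[n --> U] --> p j 0.
  have /choice [q hq] : forall j, exists q : R, x n j 0 @[n --> U] --> q.
    by move=> j; apply: ultra_segment_cvg => n; exact: xbd.
  by exists (\col_j q j) => j; rewrite mxE.
have p0 : orthant p.
  by move=> j; apply: (cvgr_to_ge (hpU j)); apply: filterE => n; exact: xo.
have pmass : \sum_i (H *m p) i 0 = \sum_i y i 0.
  have h : \sum_i (H *m x n) i 0 @[n --> U] --> \sum_i (H *m p) i 0.
    by apply: cvg_rsum => i; exact: cvg_mulmx_col.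
  apply: (cvg_unique (@norm_hausdorff _ _) h).
  have -> : (fun n => \sum_i (H *m x n) i 0) = cst (\sum_i y i 0).
    by apply/funext => n; exact: xmass.
  exact: cvg_cst.
have Hp := mulmx_gt0_of_mass H y hH hy hy0 p p0 pmass.
have llS n : loglik H y (x n) <= loglik H y (x n.+1).
  exact: loglik_em.
have llU : loglik H y (x n) @[n --> U] --> loglik H y p by exact: cvg_loglik.
have ll_le n : loglik H y (x n) <= loglik H y p.
  apply: (cvgr_to_ge llU); apply: oU; exists n => // m /= nm.
  have /nondecreasing_seqP : forall n, loglik H y (x n) <= loglik H y (x n.+1) by [].
  exact.
have pmax z : orthant z -> (forall i, 0 < (H *m z) i 0) ->
    loglik H y z <= loglik H y p.
  move=> z0 hz; rewrite leNgt; apply/negP; rewrite -subr_gt0.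
  set e := _ - _ => e0.
  (* If [z] beat [p] by [e], each step would add at least [e] to [c(z, .)], which [crossent_gap]
     bounds by [c(z, z)]. *)
  have grow n : crossent H y z (x 0%N) + n%:R * e <= crossent H y z (x n).
    elim: n => [|n IH]; first by rewrite mul0r addr0.
    have := crossent_em H y hH hy hy0 (x n) z (xp n) (hp n) z0 hz.
    rewrite -/(x n.+1); have := ll_le n.+1; rewrite -natr1 /e; move: IH; rewrite /e; lra.
  have bd n : crossent H y z (x n) <= crossent H y z z.
    rewrite -subr_ge0; apply: le_trans (crossent_gap H y hH hy (x n) z _ _ _ _) => //.
    by apply: sumr_ge0 => i _; apply: sumr_ge0 => j _; exact: sqr_ge0.
  have := Num.Theory.archi_boundP
    (_ : 0 <= (crossent H y z z - crossent H y z (x 0%N)) / e).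
  set b := Num.bound _; rewrite divr_ge0 ?(ltW e0) ?subr_ge0 // => /(_ isT).
  rewrite ltr_pdivrMr // ltrBlDl => /(le_lt_trans (bd b)).
  by rewrite ltNge grow.
pose c n := crossent H y p p - crossent H y p (x n).
(* The gap [c] is nonnegative and nonincreasing, so its limit 0 along [U] is also its limit along
   [\oo]. *)
have c0 : c n @[n --> \oo] --> 0.
  have cU : c n @[n --> U] --> 0.
    rewrite -(subrr (crossent H y p p)); apply: cvgB; first exact: cvg_cst.
    exact: cvg_crossent.
  have /nonincreasing_seqP cS : forall n, c n.+1 <= c n.
    move=> n; have := crossent_em H y hH hy hy0 (x n) p (xp n) (hp n) p0 Hp.
    rewrite -/(x n.+1); have := ll_le n.+1; rewrite /c; lra.
  have cge n : 0 <= c n.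
    rewrite /c; apply: le_trans (crossent_gap H y hH hy (x n) p _ _ _ _) => //.
    by apply: sumr_ge0 => i _; apply: sumr_ge0 => j _; exact: sqr_ge0.
  apply/cvgrPdist_lt => e e0.
  move/cvgrPdist_lt: cU => /(_ _ e0) /filter_ex [n hn].
  exists n => // m /= nm; rewrite sub0r normrN ger0_norm //.
  apply: (le_lt_trans (cS _ _ nm)).
  by move: hn; rewrite sub0r normrN ger0_norm.
have cpost i j : post H y (x n) i j @[n --> \oo] --> post H y p i j.
  have pn n : 0 <= post H y (x n) i j by apply: post_ge0.
  have pp : 0 <= post H y p i j by apply: post_ge0.
  have : Num.sqrt (post H y (x n) i j) @[n --> \oo] --> Num.sqrt (post H y p i j).
    apply: (cvg_of_sqr _ _ c _ c0) => n.
    apply: le_trans (crossent_gap H y hH hy (x n) p _ _ _ _) => //.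
    rewrite (bigD1 i) //= (bigD1 j) //= -addrA lerDl addr_ge0 //.
      by apply: sumr_ge0 => k _; exact: sqr_ge0.
    by apply: sumr_ge0 => k _; apply: sumr_ge0 => l _; exact: sqr_ge0.
  move=> sq; rewrite -(sqr_sqrtr pp) expr2.
  under eq_fun do rewrite -(sqr_sqrtr (pn _)) expr2.
  exact: (cvgM sq sq).
have w0 := em_ge0 H y hH hy hy0 p Hp p0.
have Hw := mulmx_gt0_of_mass H y hH hy hy0 _ w0 (em_mass H y hH hy hy0 p Hp).
(* The iterate [x n.+1] consists of normalized column sums of [post H y (x n)], so [cpost] gives its
   limit after an index shift. *)
have xw j : x n j 0 @[n --> \oo] --> em H y p j 0.
  rewrite -(cvg_shiftS (fun n => x n j 0)) mxE /x /=.
  under eq_fun do rewrite mxE.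
  by apply: cvgM; [apply: cvg_rsum | exact: cvg_cst].
exists (em H y p); split => // z z0 hz.
(* Both values are limits of [loglik H y (x n)] along [U], so the maximality of [p] passes to
   [em H y p]. *)
suff <- : loglik H y p = loglik H y (em H y p) by exact: pmax.
apply: (cvg_unique (@norm_hausdorff _ _) llU).
have : loglik H y (x n) @[n --> \oo] --> loglik H y (em H y p) by exact: cvg_loglik.
by apply: cvg_trans; exact: cvg_app.
Qed.

End Convergence.

(** * Scaling and stopping *)

Section Stopping.
Context {R : realType} {N M : nat}.
Implicit Types (H : 'M[R]_(N, M)) (y : 'cV[R]_N) (x z : 'cV[R]_M).

Lemma KL_loglik H y x : (forall i, 0 <= y i 0) -> (forall i, 0 < (H *m x) i 0) ->
  KL H y x = (\sum_i (y i 0 * ln (y i 0) - y i 0) - loglik H y x)%:E.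
Proof.
move=> hy hx; rewrite /KL /loglik -sumrB -sumEFin; apply: eq_bigr => i _.
rewrite /slog (gt_eqF (hx i)); have := hy i.
rewrite le_eqVlt eq_sym => /orP[/eqP ->|yi].
  by rewrite eqxx add0e; congr (_%:E); ring.
by rewrite (gt_eqF yi) -EFinD ln_div ?posrE //; congr (_%:E); ring.
Qed.

(** Zero is the only point of the orthant where positivity of [H x] can fail, hence the one that
    [KL_loglik] does not cover. *)
Lemma KL_col0 H y : (forall i, 0 <= y i 0) -> y != 0 -> KL H y 0 = +oo%E.
Proof.
move=> hy hy0; have [i yi] := data_pos y hy hy0.
have slogN j : slog (y j 0) ((H *m (0 : 'cV_M)) j 0) != -oo%E.
  by rewrite /slog mulmx0 mxE eqxx; case: ifP.
apply/eqP; rewrite /KL esum_eqy.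
  apply/existsP; exists i; rewrite /slog mulmx0 mxE eqxx.
  by rewrite (gt_eqF yi).
by move=> j _; rewrite adde_eq_ninfty negb_or slogN.
Qed.

Lemma ML_solution_loglik H y x : (forall i j, 0 < H i j) ->
  (forall i, 0 <= y i 0) -> y != 0 -> orthant x -> (forall i, 0 < (H *m x) i 0) ->
  (forall z, orthant z -> (forall i, 0 < (H *m z) i 0) ->
    loglik H y z <= loglik H y x) ->
  ML_solution H y x.
Proof.
move=> hH hy hy0 x0 hx xmax; split => // z z0.
have [->|nz] := eqVneq z 0; first by rewrite KL_col0 // leey.
have hz := mulmx_col_gt0 _ _ hH z0 nz.
by rewrite !KL_loglik // lee_fin lerB // xmax.
Qed.

Lemma vdivE {n : nat} (u v : 'cV[R]_n) : (forall i, 0 < v i 0) ->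
  vdiv u v = Some (\col_i (u i 0 / v i 0)).
Proof. by move=> hv; rewrite /vdiv ifT //; apply/forallP => i; rewrite gt_eqF. Qed.

Section Positive.
Variables (H : 'M[R]_(N, M)) (y : 'cV[R]_N).
Hypotheses (hH : forall i j, 0 < H i j) (hy : forall i, 0 <= y i 0).
Hypothesis (hy0 : y != 0).

Lemma em_backproject x j :
  (\sum_i H i j) * em H y x j 0 = x j 0 * \sum_i H i j * (y i 0 / (H *m x) i 0).
Proof.
rewrite colsum_em // big_distrr /=; apply: eq_bigr => i _; rewrite /post; ring.
Qed.

Lemma EM_step_em x : (forall i, 0 < (H *m x) i 0) ->
  EM_step H y x = Some (em H y x).
Proof.
move=> hx; have s0 j := colsum_gt0 H y hH hy hy0 j.
have sE j : (H^T *m ones) j 0 = \sum_i H i j.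
  by rewrite mxE; apply: eq_bigr => i _; rewrite !mxE mulr1.
rewrite /EM_step !vdivE //; last by move=> j; rewrite sE.
congr Some; apply/colP => j; apply: (mulfI (lt0r_neq0 (s0 j))).
rewrite em_backproject !mxE [\sum_(_ < _) _ * ones _ _](_ : _ = \sum_i H i j).
  rewrite mulrA [X in X * _]mulrC divfK ?gt_eqF //; congr (_ * _).
  by apply: eq_bigr => i _; rewrite !mxE.
by apply: eq_bigr => i _; rewrite !mxE mulr1.
Qed.

Lemma EM_method_em x k : (forall j, 0 < x j 0) -> (forall i, 0 < (H *m x) i 0) ->
  EM_method H x y k = Some (iter k (em H y) x).
Proof.
move=> x0 hx; elim: k => [//|k IH]; rewrite /EM_method iterS -/(EM_method H x y k) IH /=.
by apply: EM_step_em; have [] := em_iter_gt0 H y hH hy hy0 x k x0 hx.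
Qed.

(* Since [x (H^T 1) = s x] and [x H^T (y / Hx) = s (em x)], with [s = H^T 1],
   the backprojected residual is [s] times the EM increment. *)
Lemma CBR_em tau x : (forall i, 0 < (H *m x) i 0) ->
  CBR H tau y x =
  (\sum_j ((\sum_i H i j) * (x j 0 - em H y x j 0)) ^+ 2 <=
   tau * \sum_j x j 0 ^+ 2 * \sum_i H i j ^+ 2 / (H *m x) i 0).
Proof.
move=> hx; rewrite /CBR vdivE // /enorm sqr_sqrtr; last first.
  by apply: sumr_ge0 => j _; exact: sqr_ge0.
congr (_ <= _); apply: eq_bigr => j _; congr (_ ^+ 2).
rewrite mulrBr em_backproject [_ * x j 0]mulrC -mulrBr -sumrB !mxE.
by congr (_ * _); apply: eq_bigr => i _; rewrite !mxE; ring.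
Qed.

End Positive.

Lemma emZ H y x (L c : R) : c != 0 -> em H (L *: y) (c *: x) = L *: em H y x.
Proof.
move=> c0; apply/colP => j; rewrite !mxE mulrA; congr (_ / _).
rewrite big_distrr /=; apply: eq_bigr => i _.
rewrite /post -scalemxAr !mxE.
(* A vanishing [(H x)_i] has inverse 0, so both sides are then 0. *)
have [->|h] := eqVneq (\sum_j0 H i j0 * x j0 0) 0.
  by rewrite mulr0 invr0 !mulr0.
by field; rewrite h c0.
Qed.

(** By [emZ], one step forgets the scale of its argument and takes that of the data. The index
    starts at 1 because the initialization is not scaled. *)
Lemma em_iterZ H y x (L : R) k : L != 0 ->
  iter k.+1 (em H (L *: y)) x = L *: iter k.+1 (em H y) x.
Proof.
move=> L0; elim: k => [|k IH]; first by rewrite /= -{1}(scale1r x) emZ ?oner_neq0.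
by rewrite iterS IH emZ.
Qed.

End Stopping.

(** * The CBR test under scaling of the data *)

Section Regularization.
Context {R : realType} {N M : nat}.
Variables (H : 'M[R]_(N, M)) (y : 'cV[R]_N) (tau : R).
Hypotheses (hH : forall i j, 0 < H i j) (hy : forall i, 0 <= y i 0).
Hypotheses (hy0 : y != 0) (tau0 : 0 < tau).

Definition em_defect (x : 'cV[R]_M) : R :=
  \sum_j ((\sum_i H i j) * (x j 0 - em H y x j 0)) ^+ 2.

Definition noise_level (x : 'cV[R]_M) : R :=
  \sum_j x j 0 ^+ 2 * \sum_i H i j ^+ 2 / (H *m x) i 0.

Lemma scale_data (L : R) : 0 < L ->
  (forall i, 0 <= (L *: y) i 0) /\ L *: y != 0.
Proof.
move=> L0; rewrite scaler_eq0 negb_or gt_eqF // hy0; split => // i.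
by rewrite mxE mulr_ge0 // ltW.
Qed.

(** The left side of the test has degree 2 in [L] and the right side degree 1; one factor [L]
    cancels. *)
Lemma CBR_scale (L : R) x : 0 < L -> (forall i, 0 < (H *m x) i 0) ->
  CBR H tau (L *: y) (L *: x) = (L * em_defect x <= tau * noise_level x).
Proof.
move=> L0 hx; have [Ly Ly0] := scale_data L L0.
rewrite (CBR_em _ _ hH Ly Ly0); last first.
  by move=> i; rewrite -scalemxAr mxE mulr_gt0.
rewrite emZ ?gt_eqF // -[RHS](ler_pM2l L0); congr (_ <= _).
  rewrite mulrA -expr2 /em_defect big_distrr /=; apply: eq_bigr => j _.
  by rewrite !mxE; ring.
rewrite mulrCA; congr (_ * _); rewrite /noise_level big_distrr /=.
apply: eq_bigr => j _; rewrite mulrCA !big_distrr /=; apply: eq_bigr => i _.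
rewrite -scalemxAr [(L *: x) j 0]mxE [(L *: (H *m x)) i 0]mxE.
by field; rewrite !gt_eqF.
Qed.

(** With [x] fixed, the left side grows like the square of [L] while the right side does not depend
    on [L]. This rules out stopping at index 0. *)
Lemma CBR_fails (x : 'cV[R]_M) (j : 'I_M) : (forall j, 0 < x j 0) ->
  (forall i, 0 < (H *m x) i 0) ->
  exists L0, forall L, 0 < L -> L0 < L -> ~~ CBR H tau (L *: y) x.
Proof.
move=> x0 hx; have s0 := colsum_gt0 H y hH hy hy0 j; set s := \sum_i H i j in s0.
have e0 := em_gt0 H y hH hy hy0 x hx x0 j; set e := em H y x j 0 in e0.
set b := tau * noise_level x.
exists ((x j 0 + (Num.max b 0 + 1) / s) / e) => L L0.
rewrite ltr_pdivrMr // -ltrBrDl ltr_pdivrMr // => hL.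
have [Ly Ly0] := scale_data L L0.
rewrite (CBR_em _ _ hH Ly Ly0) // -ltNge -/(noise_level x) -/b.
have -> : em H (L *: y) x = L *: em H y x.
  by rewrite -[in LHS](scale1r x) emZ ?oner_neq0.
rewrite (bigD1 j) //= ltr_wpDr //.
  by apply: sumr_ge0 => k _; exact: sqr_ge0.
rewrite -/s mxE -/e.
have h1 : b <= Num.max b 0 by rewrite le_max lexx.
have h2 : 0 <= Num.max b 0 by rewrite le_max lexx orbT.
have : (Num.max b 0 + 1) ^+ 2 < (s * (x j 0 - L * e)) ^+ 2.
  rewrite -[X in _ < X]sqrrN ltr_pXn2r ?nnegrE //; lra.
by nra.
Qed.

Lemma em_fixed_iter (x : 'cV[R]_M) : em_defect x = 0 ->
  forall n, iter n (em H y) x = x.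
Proof.
move=> dx; have fx : em H y x = x.
  apply/colP => j; have /eqP := dx; rewrite psumr_eq0; last first.
    by move=> k _; exact: sqr_ge0.
  move=> /allP /(_ j (mem_index_enum _)); rewrite implyTb sqrf_eq0 mulf_eq0.
  by rewrite gt_eqF ?(colsum_gt0 H y) // subr_eq0 => /eqP.
by elim=> [//|n IH]; rewrite iterS IH.
Qed.

(** The increments of a convergent sequence vanish, whereas the right side tends to
    [tau * noise_level w], which is positive. *)
Lemma em_CBR_eventually (x : nat -> 'cV[R]_M) (w : 'cV[R]_M) (L : R) :
  (forall n, x n.+1 = em H y (x n)) -> orthant w ->
  (forall i, 0 < (H *m w) i 0) ->
  (forall j, x n j 0 @[n --> \oo] --> w j 0) ->
  exists n, L * em_defect (x n) <= tau * noise_level (x n).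
Proof.
move=> xS w0 hw xw.
have cd : em_defect (x n) @[n --> \oo] --> 0.
  rewrite [X in _ --> X](_ : 0 =
    \sum_(j < M) ((\sum_i H i j) * (w j 0 - w j 0)) ^+ 2); last first.
    by rewrite big1 // => j _; rewrite subrr mulr0 expr0n.
  apply: cvg_rsum => j.
  have c : (\sum_i H i j) * (x n j 0 - em H y (x n) j 0) @[n --> \oo] -->
      (\sum_i H i j) * (w j 0 - w j 0).
    apply: cvgM; first exact: cvg_cst.
    apply: cvgB => //; under eq_fun do rewrite -xS.
    by have := xw j; rewrite -(cvg_shiftS (fun n => x n j 0)).
  by under eq_fun do rewrite expr2; rewrite expr2; exact: (cvgM c c).
have cn : noise_level (x n) @[n --> \oo] --> noise_level w.
  apply: cvg_rsum => j; apply: cvgM.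
    by under eq_fun do rewrite expr2; rewrite expr2; exact: (cvgM (xw j) (xw j)).
  apply: cvg_rsum => i; apply: cvgM; first exact: cvg_cst.
  by apply: cvgV; [rewrite gt_eqF | exact: cvg_mulmx_col].
have n0 : 0 < noise_level w.
  have [i yi] := data_pos y hy hy0.
  have /matrix0Pn[j [k]] : w != 0.
    by apply: contraTneq (hw i) => ->; rewrite mulmx0 mxE ltxx.
  rewrite (ord1 k) => wj; rewrite /noise_level (bigD1 j) //= ltr_wpDr //.
    apply: sumr_ge0 => l _; rewrite mulr_ge0 ?sqr_ge0 //.
    by apply: sumr_ge0 => m _; rewrite divr_ge0 ?sqr_ge0 // ltW.
  rewrite mulr_gt0 //; first by rewrite exprn_even_gt0.
  rewrite (bigD1 i) //= ltr_wpDr //; last by rewrite divr_gt0 // exprn_gt0.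
  by apply: sumr_ge0 => m _; rewrite divr_ge0 ?sqr_ge0 // ltW.
have c : tau * noise_level (x n) - L * em_defect (x n) @[n --> \oo] -->
    tau * noise_level w - L * 0.
  by apply: cvgB; apply: cvgM => //; exact: cvg_cst.
have : \forall n \near \oo, 0 < tau * noise_level (x n) - L * em_defect (x n).
  by apply: (cvgr_gt _ c); rewrite mulr0 subr0 mulr_gt0.
by move=> /filter_ex [n]; rewrite subr_gt0 => /ltW h; exists n.
Qed.

End Regularization.

Theorem theorem4p2 (R : realType) (N M : nat) (hM : (0 < M)%N)
  (H : 'M[R]_(N, M)) (hH : forall i j, 0 < H i j)
  (y : 'cV[R]_N) (hy0 : y != 0) (hy : forall i, 0 <= y i 0)
  (tau : R) (htau : 0 < tau)
  (x0 : 'cV[R]_M) (hx0 : forall j, 0 < x0 j 0) :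
  regularization_method H y (EM_method H x0) (CBR H tau).
Proof.
have x0o : orthant x0 by move=> j; exact: ltW.
have x0n : x0 != 0.
  by apply/matrix0Pn; exists (Ordinal hM), 0; rewrite gt_eqF.
have hx0p := mulmx_col_gt0 _ _ hH x0o x0n.
split=> [x xo xn k|].
  have hx := mulmx_col_gt0 _ _ hH xo xn.
  rewrite EM_method_em // => [i|]; first exact: ltW.
  have [i _] := data_pos y hy hy0.
  by apply/matrix0Pn; exists i, 0; rewrite gt_eqF.
(* The sequence starts at the first EM iterate, from which on the mass is that of [y] and [em_iterZ]
   applies. *)
pose x n := iter n.+1 (em H y) x0.
have xE n : x n = iter n (em H y) (em H y x0) by rewrite /x iterSr.
have xp n : (forall j, 0 < x n j 0) /\ (forall i, 0 < (H *m x n) i 0).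
  exact: em_iter_gt0.
have [w [wo hw xw wmax]] : exists w : 'cV[R]_M,
    [/\ orthant w, forall i, 0 < (H *m w) i 0,
    forall j, x n j 0 @[n --> \oo] --> w j 0 &
    forall z, orthant z -> (forall i, 0 < (H *m z) i 0) ->
      loglik H y z <= loglik H y w].
  have [] := em_cvg_max H y hH hy hy0 (em H y x0) (proj1 (xp 0%N)) (proj2 (xp 0%N)).
    exact: em_mass.
  move=> w [wo hw xw wmax]; exists w; split => // j.
  by under eq_fun do rewrite xE; exact: xw.
have XE L k : 0 < L ->
    EM_method H x0 (L *: y) k = Some (iter k (em H (L *: y)) x0).
  by move=> L0; have [Ly Ly0] := scale_data y hy hy0 L L0; exact: EM_method_em.
have stopE L n : 0 < L -> CBR H tau (L *: y) (iter n.+1 (em H (L *: y)) x0) =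
    (L * em_defect H y (x n) <= tau * noise_level H (x n)).
  move=> L0; rewrite em_iterZ ?gt_eqF // CBR_scale //.
  by have [] := xp n.
(* The first stopping index and its iterate are chosen together; the pair is arbitrary for
   [L <= 0]. *)
have /choice [f hf] : forall L : R, exists kx : nat * 'cV[R]_M, 0 < L ->
    first_stop (EM_method H x0) (CBR H tau) (L *: y) kx.1 kx.2.
  move=> L; have [L0|nL] := ltP 0 L; last by exists (0%N, 0).
  have ex : exists k, CBR H tau (L *: y) (iter k (em H (L *: y)) x0).
    have [n hn] := em_CBR_eventually H y tau hH hy hy0 htau x w L (fun=> erefl) wo hw xw.
    by exists n.+1; rewrite stopE.
  case: (ex_minnP ex) => k hk kmin.
  exists (k, iter k (em H (L *: y)) x0) => _; split => //=; first exact: XE.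
  move=> l z lk; rewrite XE // => -[<-]; apply/negP => /kmin.
  by rewrite leqNgt lk.
exists (fun L => (f L).1), (fun L => (f L).2); split => //.
exists w; first exact: ML_solution_loglik.
have [L0 hL0] := CBR_fails H y tau hH hy hy0 x0 (Ordinal hM) hx0 hx0p.
apply/cvg_ballP => e e0.
have [K hK] : exists K, forall n, (K <= n)%N -> ball w e (x n).
  have : \forall n \near \oo, forall j, `|w j 0 - x n j 0| < e.
    apply: filter_forall => j; by move/cvgrPdist_lt: (xw j); apply.
  move=> [K _ hK]; exists K => n Kn; split => // i j.
  by rewrite (ord1 j); exact: hK.
(* The sum dominates each of the finitely many ratios that allow a stop before [K]; a zero defect
   contributes 0 and is treated apart. *)
pose L1 := \sum_(n < K) `|tau * noise_level H (x n) / em_defect H y (x n)|.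
exists (Num.max 0 (Num.max L0 L1)); split; first exact: num_real.
move=> L; rewrite !gt_max => /and3P[Lp LL0 LL1].
have [] := hf L Lp; case: (f L) => k z /=; rewrite XE // => -[<-] {z}.
case: k => [|n]; first by rewrite (negbTE (hL0 L Lp LL0)).
rewrite stopE // em_iterZ ?gt_eqF // scalerA mulVf ?gt_eqF // scale1r -/(x n) => st _.
have [/hK//|nK] := leqP K n.
(* With zero defect EM is stationary from [x n] on, so [x n] equals a late iterate and lies in the
   ball; otherwise [L > L1] contradicts the test. *)
have [d0|d0] := eqVneq (em_defect H y (x n)) 0.
  suff -> : x n = x (K + n)%N by apply: hK; exact: leq_addr.
  rewrite -{1}(em_fixed_iter H y hH hy hy0 (x n) d0 K) /x -iterD addnS //.
have dp : 0 < em_defect H y (x n).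
  by rewrite lt_def d0; apply: sumr_ge0 => j _; exact: sqr_ge0.
move: st; rewrite -ler_pdivlMr // leNgt => /negP[]; apply: le_lt_trans LL1.
rewrite /L1 (bigD1 (Ordinal nK)) //=; apply: le_trans (ler_norm _) _.
by rewrite lerDl; apply: sumr_ge0.
Qed.
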